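(* Let $n \ge 7$ be an integer. The following statements are equivalent: (a) there exists a 6-valent first-kind Frobenius circulant $TL_n(a,b,1)$ of order $n$ such that the kernel of the underlying Frobenius group is cyclic (i.e. isomorphic to $\mathbb{Z}_n$); (b) $n \equiv 1 \pmod 6$ and the congruence $x^2 - x + 1 \equiv 0 \pmod n$ has a solution. Moreover, if one of these conditions holds, then: (c) every prime factor of $n$ is congruent to $1$ modulo $6$; (d) each solution $a$ of $x^2 - x + 1 \equiv 0 \pmod n$ gives rise to a 6-valent first-kind Frobenius circulant $TL_n(a,b,1)$, and vice versa; in this case $b \equiv a-1 \pmod n$, and $TL_n(a,a-1,1)$ is a rotational, geometric, $\mathbb{Z}_n \rtimes H$-arc-transitive, first-kind $\mathbb{Z}_n \rtimes H$-Frobenius graph admitting $[a]$ and $-[a^2]$ as complete rotations, where $$H = \langle [a] \rangle = \{\pm[1], \pm[a], \pm[a^2]\} = \{\pm[1],\pm[a],\pm[a-1]\} \le \mathbb{Z}_n^*;$$ (e) there are exactly $2^{l-1}$ pairwise non-isomorphic 6-valent first-kind Frobenius circulants (with cyclic kernel) of order $n$, where $l$ is the number of distinct prime factors of $n$, and each of them is isomorphic to $TL_n(a,a-1,1)$ for some solution $a$ of $x^2-x+1\equiv 0 \pmod n$.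
   Context: $\mathbb{Z}_n$ is the integers modulo $n$, $[m]$ denotes the residue class of $m$ modulo $n$, and $\mathbb{Z}_n^*$ is the group of units, identified with $\mathrm{Aut}(\mathbb{Z}_n)$ acting by multiplication. For a group $K$ and an inverse-closed $S \subseteq K\setminus\{1\}$, the Cayley graph $\mathrm{Cay}(K,S)$ has vertex set $K$, with $x,y$ adjacent iff $xy^{-1}\in S$. For integers $1\le a,b,c\le n-1$ with $a,b,c,n-a,n-b,n-c$ pairwise distinct, $TL_n(a,b,c)=\mathrm{Cay}(\mathbb{Z}_n,\{\pm[a],\pm[b],\pm[c]\})$ (additive group). $TL_n(a,b,c)$ is geometric if $a'+b'+c'\equiv 0 \pmod n$ for some $a'\in\{a,n-a\}$, $b'\in\{b,n-b\}$, $c'\in\{c,n-c\}$. A complete rotation of $\mathrm{Cay}(K,S)$ is an automorphism of the group $K$ fixing $S$ setwise and inducing a cyclic permutation on $S$; the graph is rotational if it admits one. A graph is $G$-arc-transitive if $G$ is a group of automorphisms transitive on ordered pairs of adjacent vertices. A Frobenius group is a transitive permutation group that is not regular and in which only the identity fixes two points; a finite Frobenius group is $G=K\rtimes H$ with $K$ (the kernel) a regular normal subgroup and $H$ (a complement) a point stabiliser; identifying the point set with $K$, $H$ acts on $K$ by conjugation. A first-kind $G$-Frobenius graph is $\mathrm{Cay}(K,s^H)$ where $s\in K$, $\langle s^H\rangle=K$, and either $|H|$ is even or $s$ is an involution. Here $\mathbb{Z}_n\rtimes H$ for $H\le\mathbb{Z}_n^*$ acts on $\mathbb{Z}_n$ by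 $[x]^{([y],[m])}=[(x+y)m]$. A 6-valent first-kind Frobenius circulant with cyclic kernel is a 6-valent circulant $TL_n(a,b,1)$ which is a first-kind $\mathbb{Z}_n\rtimes H$-Frobenius graph for some $H\le \mathbb{Z}_n^*$ such that $\mathbb{Z}_n\rtimes H$ is a Frobenius group with kernel $\mathbb{Z}_n$. *)

(* Defs.v *)
From HB Require Import structures.
From mathcomp Require Import all_boot all_order all_algebra all_fingroup.

Set Implicit Arguments.
Unset Strict Implicit.
Unset Printing Implicit Defensive.

Import GRing.Theory.
Local Open Scope ring_scope.

(* Throughout, n is the modulus; 'Z_n is the ring Z/nZ (used only for n >= 7).
   Elements of Z_n^* = Aut(Z_n) are units u : {unit 'Z_n}, acting by
   multiplication. *)

Definition TLset (n a b c : nat) : {set 'Z_n} :=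
  [set (a%:R : 'Z_n); - a%:R; b%:R; - b%:R; c%:R; - c%:R].

Definition TL_param (n a b c : nat) : bool :=
  [&& (0 < a < n)%N, (0 < b < n)%N, (0 < c < n)%N
    & uniq [:: a; b; c; (n - a)%N; (n - b)%N; (n - c)%N]].

Definition cay_adj (n : nat) (S : {set 'Z_n}) (x y : 'Z_n) : bool :=
  (x - y) \in S.

Definition graph_iso (n : nat) (S1 S2 : {set 'Z_n}) : Prop :=
  exists f : {perm 'Z_n}, forall x y, cay_adj S1 x y = cay_adj S2 (f x) (f y).

Definition geometric (n a b c : nat) : Prop :=
  exists a' b' c' : nat,
    [/\ a' \in [:: a; (n - a)%N], b' \in [:: b; (n - b)%N],
        c' \in [:: c; (n - c)%N] & ((a' + b' + c') %% n = 0)%N].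

(* The automorphism x |-> m x of Z_n is a complete rotation of Cay(Z_n,S):
   it fixes S setwise and induces a cyclic permutation (a single cycle)
   on S. *)
Definition complete_rotation (n : nat) (S : {set 'Z_n}) (m : {unit 'Z_n}) : Prop :=
  (forall x, x \in S -> val m * x \in S) /\
  (forall s t, s \in S -> t \in S -> exists k : nat, (val m) ^+ k * s = t).

Definition rotational (n : nat) (S : {set 'Z_n}) : Prop :=
  exists m : {unit 'Z_n}, complete_rotation S m.

(* The group Z_n x| H acting on Z_n by [x]^([y],[m]) = [(x+y)m]. *)
Definition ZnH_act (n : nat) (p : 'Z_n * {unit 'Z_n}) (x : 'Z_n) : 'Z_n :=
  (x + p.1) * val p.2.

Definition ZnH (n : nat) (H : {set {unit 'Z_n}}) : {set 'Z_n * {unit 'Z_n}} :=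
  [set p | p.2 \in H].

(* Z_n x| H is a Frobenius group (transitive, not regular, only the identity
   fixes two points) whose Frobenius kernel (identity together with the
   fixed-point-free elements) is the translation subgroup Z_n. *)
Definition frobenius_cyclic_kernel (n : nat) (H : {set {unit 'Z_n}}) : Prop :=
  [/\ forall x y : 'Z_n, exists2 p, p \in ZnH H & ZnH_act p x = y,
      exists2 p, p \in ZnH H &
        (exists x, ZnH_act p x = x) /\ ~ (forall z, ZnH_act p z = z),
      forall p, p \in ZnH H -> forall x1 x2 : 'Z_n, x1 != x2 ->
        ZnH_act p x1 = x1 -> ZnH_act p x2 = x2 -> forall z, ZnH_act p z = z
    & forall p, p \in ZnH H ->
        (p.2 = 1%g <-> (forall z, ZnH_act p z = z) \/ (forall z, ZnH_act p z != z))].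

Definition orbitH (n : nat) (H : {set {unit 'Z_n}}) (s : 'Z_n) : {set 'Z_n} :=
  [set s * val h | h in H].

Definition first_kind (n : nat) (H : {set {unit 'Z_n}}) (S : {set 'Z_n}) : Prop :=
  exists s : 'Z_n,
    [/\ S = orbitH H s, (<<orbitH H s>>)%g = [set: 'Z_n]
      & ~~ odd #|H| \/ (s != 0 /\ s + s = 0)].

Definition arc_transitive (n : nat) (H : {set {unit 'Z_n}}) (S : {set 'Z_n}) : Prop :=
  (forall p, p \in ZnH H -> forall x y,
      cay_adj S x y = cay_adj S (ZnH_act p x) (ZnH_act p y)) /\
  (forall x y x' y', cay_adj S x y -> cay_adj S x' y' ->
      exists2 p, p \in ZnH H & ZnH_act p x = x' /\ ZnH_act p y = y').

Definition frob_circ (n a b : nat) : Prop :=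
  TL_param n a b 1 /\
  exists H : {group {unit 'Z_n}},
    frobenius_cyclic_kernel H /\ first_kind H (TLset n a b 1).

Definition hex_sol (n : nat) (x : 'Z_n) : Prop := x ^+ 2 - x + 1 = 0.

(* Main.v *)
Require Import Defs.
From HB Require Import structures.
From mathcomp Require Import all_boot all_order all_algebra all_fingroup.
From mathcomp Require Import cyclic zify ring.

(** A solution [w] of x^2 - x + 1 = 0 modulo [n] is a sixth root of unity with
    w^2 = w - 1 and w^3 = -1, so the connection set is the hexagon of powers
    {1, w, w - 1, -1, -w, 1 - w}.  When [n] is coprime to 6, differences of
    distinct powers of [w] divide 6, hence are units: this is the Frobenius
    property.  Conversely, in a first-kind Frobenius circulant the connection
    set contains 1 and is therefore a group of units of order 6 whose elements
    other than 1 differ from 1 by a unit; factoring a^6 - 1 then leaves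
    a^2 - a + 1 = 0 or a^2 + a + 1 = 0.

    Solutions correspond to idempotents [e] through y = x + e (1 - 2x), since
    (1 - 2x)^2 = -3 is a unit, and idempotents correspond to sets of primes
    dividing [n].

    For n > 7 the neighbours of a vertex induce exactly a hexagon, so graph
    isomorphisms preserve antipodal pairs of neighbours and hence map lines to
    lines; as 1 generates Z_n they are affine, which forces the connection sets
    to coincide, i.e. the roots to agree up to w |-> 1 - w. *)

Set Implicit Arguments.
Unset Strict Implicit.
Unset Printing Implicit Defensive.

Import GRing.Theory.
Local Open Scope ring_scope.

(** * Powers of a root of x^2 - x + 1 in a commutative ring *)

Section HexRing.
Variable R : comUnitRingType.
Implicit Types a x y : R.

(** The entry [a - 1] stands for a^2, and the order agrees with the list in [TL_paramE]. *)
Definition hexseq a : seq R := [:: 1; -1; a; - a; a - 1; - (a - 1)].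

Lemma hexseqP a x : reflect (exists e : bool, exists2 y, y \in [:: 1; a; a - 1] & x = (-1) ^+ e * y)
  (x \in hexseq a).
Proof.
rewrite !inE; apply: (iffP idP) => [|[e [y]]].
  case/or4P => [/eqP->|/eqP->|/eqP->|/or3P[]/eqP->];
   [exists false, 1|exists true, 1|exists false, a|exists true, a
   |exists false, (a - 1)|exists true, (a - 1)];
   rewrite ?inE ?eqxx ?orbT ?expr0 ?expr1 ?mul1r ?mulN1r //.
by rewrite !inE => /or3P[] /eqP-> ->; case: e;
  rewrite ?expr0 ?expr1 ?mul1r ?mulN1r ?eqxx ?orbT.
Qed.

Lemma hexseqN a x : x \in hexseq a -> - x \in hexseq a.
Proof.
case/hexseqP => e [y ys ->]; apply/hexseqP; exists (~~ e), y => //.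
by case: e; rewrite ?expr0 ?expr1 !mul1r ?mulN1r ?opprK.
Qed.

Hypotheses (U2 : 2%:R \is a @GRing.unit R) (U3 : 3%:R \is a @GRing.unit R).
Variables (a : R) (ha : a ^+ 2 - a + 1 = 0).

Lemma hexE : a ^+ 2 = a - 1.
Proof. by apply/eqP; rewrite -subr_eq0 -ha; apply/eqP; ring. Qed.

Lemma hex_cube : a ^+ 3 = - 1.
Proof. by rewrite exprS hexE mulrBr mulr1 -expr2 hexE; ring. Qed.

Lemma hexseq_mul x : x \in hexseq a -> a * x \in hexseq a.
Proof.
have a1 : a * (a - 1) = -1 by rewrite -hexE -exprS hex_cube.
have a2 : a * a = a - 1 by rewrite -expr2 hexE.
case/hexseqP => e [y ys ->]; rewrite mulrCA.
have ay: a * y \in hexseq a.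
  by rewrite !inE in ys; case/or3P: ys => /eqP->; rewrite ?mulr1 ?a1 ?a2 !inE eqxx ?orbT.
by case: e; rewrite ?expr0 ?expr1 ?mul1r ?mulN1r ?hexseqN.
Qed.

Lemma hex_unit : a \is a GRing.unit.
Proof.
by apply/unitrP; exists (1 - a); suff: (1 - a) * a = 1 by [move=> e; split; rewrite // mulrC];
  rewrite mulrBl mul1r -expr2 hexE; ring.
Qed.

(** Up to sign every difference is 1, a + 1, a - 2, 2a - 1 or a product of some of 2, a, a - 1.
    Since (a + 1)(a - 2) = -3 and (2a - 1)^2 = -3, all of these are units. *)
Lemma hexseq_pairwise_sub_unit :
  pairwise (fun x y => x - y \is a GRing.unit) (hexseq a).
Proof.
have Ua := hex_unit.
have Ua1 : a - 1 \is a GRing.unit by rewrite -hexE unitrX.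
have e3 : (a + 1) * (a - 2%:R) = - 3%:R.
  have -> : (a + 1) * (a - 2%:R) = a ^+ 2 - a + 1 - 3%:R by ring.
  by rewrite ha sub0r.
have : (a + 1) * (a - 2%:R) \is a GRing.unit by rewrite e3 unitrN.
rewrite unitrM => /andP[Uap Uam].
have U21 : 2%:R * a - 1 \is a GRing.unit.
  rewrite -(@unitrX_pos _ _ 2) //.
  have -> : (2%:R * a - 1) ^+ 2 = 4%:R * (a ^+ 2 - a + 1) - 3%:R by ring.
  by rewrite ha mulr0 sub0r unitrN.
rewrite /= !andbT.
  have -> : 1 - -1 = 2%:R :> R by ring.
  have -> : 1 - a = - (a - 1) by ring.
  have -> : 1 - - a = a + 1 by ring.
  have -> : 1 - (a - 1) = - (a - 2%:R) by ring.
  have -> : 1 - - (a - 1) = a by ring.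
  have -> : -1 - a = - (a + 1) by ring.
  have -> : -1 - - a = a - 1 by ring.
  have -> : -1 - (a - 1) = - a by ring.
  have -> : -1 - - (a - 1) = a - 2%:R by ring.
  have -> : a - - a = 2%:R * a by ring.
  have -> : a - (a - 1) = 1 by ring.
  have -> : a - - (a - 1) = 2%:R * a - 1 by ring.
  have -> : - a - (a - 1) = - (2%:R * a - 1) by ring.
  have -> : - a - - (a - 1) = - 1 by ring.
  have -> : a - 1 - - (a - 1) = 2%:R * (a - 1) by ring.
  by rewrite !unitrN !unitrM !unitr1 U2 Ua Ua1 Uap Uam U21.
Qed.

Lemma hexseq_sub_unit x y : x \in hexseq a -> y \in hexseq a -> x != y ->
  x - y \is a GRing.unit.
Proof.
move/(pairwiseP 0): hexseq_pairwise_sub_unit => P.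
move=> /(nthP 0)[i ilt <-] /(nthP 0)[j jlt <-].
case: (ltngtP i j) => [ij|ji|->]; last by rewrite eqxx.
  by move=> _; apply: P.
by move=> _; rewrite -unitrN opprB; apply: P.
Qed.

Lemma hexseq_uniq : uniq (hexseq a).
Proof.
rewrite uniq_pairwise; apply: sub_pairwise hexseq_pairwise_sub_unit => x y.
by apply: contraTN => /eqP->; rewrite subrr unitr0.
Qed.

End HexRing.

Lemma perm_pairs (T : eqType) (a b c a' b' c' : T) :
  perm_eq [:: a; b; c; a'; b'; c'] [:: c; c'; a; a'; b; b'].
Proof. by apply/seq.permP => p /=; lia. Qed.

(** * Groups of units of Z_n and the Frobenius condition *)

Section Zmod.
Variables (n : nat) (n1 : (1 < n)%N).
Implicit Types (w x y : 'Z_n) (u h : {unit 'Z_n}) (H : {group {unit 'Z_n}}).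

Lemma natr_Zp_inj : {in [pred k | (k < n)%N] &, injective (fun k => k%:R : 'Z_n)}.
Proof.
move=> i j; rewrite !inE => ilt jlt /(congr1 val) /=.
by rewrite !val_Zp_nat // !modn_small.
Qed.

Lemma ltn_val_Zp x : (val x < n)%N.
Proof. by have := ltn_ord x; rewrite [X in (_ < X)%N]Zp_cast. Qed.

Lemma natrN_Zp a : (a < n)%N -> (n - a)%:R = - a%:R :> 'Z_n.
Proof. by move=> an; rewrite natrB ?(ltnW an) // pchar_Zp // sub0r. Qed.

(** The cast to ['Z_n] is injective below n and sends n - k to -k, so distinct integers become
    distinct residues. *)
Lemma TL_paramE a b : TL_param n a b 1 =
  [&& (0 < a < n)%N, (0 < b < n)%N &
      uniq [:: 1; - 1; a%:R; - a%:R; b%:R; - b%:R : 'Z_n]].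
Proof.
apply: andb_id2l => /andP[a0 an]; apply: andb_id2l => /andP[b0 bn].
rewrite n1 andTb (perm_uniq (perm_pairs _ _ _ _ _ _)) -(map_inj_in_uniq (f := fun k => k%:R : 'Z_n)).
  by congr uniq; rewrite [map _ _]/= !natrN_Zp.
apply: sub_in2 natr_Zp_inj => i; rewrite !inE.
by case/or4P => [/eqP->|/eqP->|/eqP->|/or3P[]/eqP->] //;
  rewrite -[X in (_ < X)%N]subn0 ltn_sub2l ?subn0 // (leq_trans _ n1).
Qed.

(** By finiteness an injective multiplication is bijective, and the preimage of 1 is an inverse. *)
Lemma inj_mul_unit_Zp x : (forall y, x * y = 0 -> y = 0) -> x \is a GRing.unit.
Proof.
move=> inj; have xI : injective ( *%R x).
  move=> y z e; apply/eqP; rewrite -subr_eq0; apply/eqP/inj.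
  by rewrite mulrBr e subrr.
have [g _ gK] := injF_bij xI.
by apply/unitrP; exists (g 1); rewrite mulrC gK.
Qed.

Definition unit_val H : {set 'Z_n} := [set val h | h in H].

Lemma unit_valP H x : reflect (exists2 h, h \in H & x = val h) (x \in unit_val H).
Proof. exact: imsetP. Qed.

Lemma unit_valM H x y : x \in unit_val H -> y \in unit_val H -> x * y \in unit_val H.
Proof.
case/unit_valP => h hH -> /unit_valP[k kH ->].
by apply/unit_valP; exists (h * k)%g; rewrite ?groupM ?FinRing.val_unitM.
Qed.

Lemma orbitH1 H : orbitH H 1 = unit_val H.
Proof. by apply: eq_imset => h; rewrite mul1r. Qed.

(** If 1 = s h then s = h^-1 lies in H, so the coset sH is H. *)
Lemma orbitH_mem1 H s : 1 \in orbitH H s -> orbitH H s = unit_val H.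
Proof.
case/imsetP => h hH e1; apply/setP => x.
have es : s = val h^-1%g.
  have hU := valP h.
  by rewrite -[LHS]mulr1 -(mulrV hU) mulrA -e1 mul1r.
apply/imsetP/unit_valP => -[k kH ->].
  exists (h^-1 * k)%g; first by rewrite groupM ?groupV.
  by rewrite FinRing.val_unitM -es.
by exists (h * k)%g; rewrite ?groupM // es -FinRing.val_unitM mulKg.
Qed.

Lemma gen_set1_Zp (A : {set 'Z_n}) : 1 \in A -> (<<A>>)%g = [set: 'Z_n].
Proof.
move=> A1; apply/eqP; rewrite -subTset Zp_cycle cycle_subG.
exact: mem_gen.
Qed.

Lemma arc_transitive_unit_val H : arc_transitive H (unit_val H).
Proof.
split=> [[t h] | x y x' y'].
  rewrite inE /= => hH x y; rewrite /cay_adj /ZnH_act /= -mulrBl.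
  have -> : x + t - (y + t) = x - y by ring.
  apply/idP/idP => [xy|/unit_valP[k kH e]].
    by apply: unit_valM => //; apply/unit_valP; exists h.
  apply/unit_valP; exists (k * h^-1)%g; first by rewrite groupM ?groupV.
  by rewrite FinRing.val_unitM FinRing.val_unitV -e (mulrK (valP h)).
rewrite /cay_adj => /unit_valP[h hH e] /unit_valP[k kH e'].
(* The multiplier h^-1 k carries the difference h of the first arc to the difference k of the
   second; the translation is then fixed by sending x to x'. *)
have E : val k = val h * val (h^-1 * k)%g by rewrite -FinRing.val_unitM mulKVg.
exists (x' / val (h^-1 * k)%g - x, (h^-1 * k)%g).
  by rewrite inE /= groupM ?groupV.
have U := valP (h^-1 * k)%g.
rewrite /ZnH_act [p in p.1]/= [p in p.2]/=; split.
  by rewrite addrC subrK divrK.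
have -> : y = x - val h by rewrite -e subKr.
by rewrite addrC addrA subrK mulrBl divrK // -E -e' subKr.
Qed.

Lemma complete_rotation_cycle u : complete_rotation (unit_val <[u]>) u.
Proof.
split=> [x|s t]; first by apply: unit_valM; apply/unit_valP; exists u => //; apply: cycle_id.
case/unit_valP => h hu -> /unit_valP[k ku ->].
have /cycleP[i ei] : (k * h^-1)%g \in <[u]>%g by rewrite groupM ?groupV.
exists i.
by rewrite -FinRing.val_unitX -ei -FinRing.val_unitM mulgKV.
Qed.

(** If (h - 1) y = 0 with y nonzero, multiplication by h fixes both 0 and y, hence is trivial. So h
    - 1 is not a zero divisor. *)
Lemma frobenius_sub1_unit H h : frobenius_cyclic_kernel H -> h \in H -> h != 1%g ->
  val h - 1 \is a GRing.unit.
Proof.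
case=> _ _ fix2 _ hH h1; apply: inj_mul_unit_Zp => y hy.
apply/eqP; apply: contraT => y0; case/eqP: h1; apply: val_inj.
have hH0 : (0, h) \in ZnH H by rewrite inE.
have act0 z : ZnH_act (0, h) z = z * val h by rewrite /ZnH_act addr0.
have hy1 : ZnH_act (0, h) y = y.
  by apply/eqP; rewrite act0 -subr_eq0 -[X in _ - X]mulr1 -mulrBr mulrC hy.
have := fix2 _ hH0 _ _ y0 hy1 _ 1; rewrite !act0 mul1r; apply.
by rewrite mul0r.
Qed.

Lemma frobenius_of_sub1_unit H : (exists2 h, h \in H & h != 1%g) ->
  (forall h, h \in H -> h != 1%g -> val h - 1 \is a GRing.unit) ->
  frobenius_cyclic_kernel H.
Proof.
move=> [h0 h0H h01] hU; split.
- by move=> x y; exists (y - x, 1%g); rewrite ?inE //= /ZnH_act /= mulr1 addrC subrK.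
- exists (0, h0); first by rewrite inE.
  split; first by exists 0; rewrite /ZnH_act /= !add0r mul0r.
  by move/(_ 1); rewrite /ZnH_act /= addr0 mul1r => e; case/eqP: h01; apply: val_inj.
- case=> [t h]; rewrite inE /ZnH_act /= => hH x1 x2 x12 e1 e2 z.
  have [h1|h1] := eqVneq h 1%g.
    rewrite h1 /= !mulr1 in e1 *.
    by have -> : t = 0 by [apply: (addrI x1); rewrite addr0]; rewrite addr0.
  (* The difference of two fixed points is annihilated by the unit h - 1. *)
  case/eqP: x12; apply/eqP; rewrite -subr_eq0.
  rewrite -(mulIr_eq0 _ (mulIr (hU _ hH h1))).
  have -> : (x1 - x2) * (val h - 1) = ((x1 + t) * val h - x1) - ((x2 + t) * val h - x2) by ring.
  by rewrite e1 e2 !subrr.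
case=> [t h]; rewrite inE /ZnH_act /= => hH; split=> [->|[e|e]].
- have [->|t0] := eqVneq t 0; [left|right] => z; rewrite /= mulr1 ?addr0 //.
  by rewrite -subr_eq0 addrAC subrr add0r.
- have t0 : t = 0.
    have := e 0; rewrite add0r => /(congr1 ( *%R^~ (val h)^-1)).
    by rewrite mul0r mulrK // (valP h).
  by apply: val_inj; have := e 1; rewrite t0 addr0 mul1r.
apply/eqP; apply: contraT => h1; have U := hU _ hH h1.
(* The solution of (z + t) h = z: when h is not 1 the element has a fixed point, so it is not in the
   kernel. *)
set z := - t * val h / (val h - 1).
have zE : z * (val h - 1) = - t * val h by rewrite divrK.
have := e z; rewrite -subr_eq0 => /negP[].
have -> : (z + t) * val h - z = z * (val h - 1) + t * val h by ring.
by rewrite zE mulNr addNr.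
Qed.

End Zmod.

(** * From a root modulo n to a Frobenius circulant *)

Definition hexset (n : nat) (w : 'Z_n) : {set 'Z_n} := [set x in hexseq w].

Lemma coprime6_units (n : nat) : (1 < n)%N -> coprime n 6 =
  (2%:R \is a @GRing.unit 'Z_n) && (3%:R \is a @GRing.unit 'Z_n).
Proof. by move=> n1; rewrite !unitZpE // -[6%N]/(2 * 3)%N coprimeMr. Qed.

Lemma TLset_hexset (n : nat) (w : 'Z_n) (a b : nat) :
  a%:R = w \/ a%:R = - w -> b%:R = w - 1 \/ b%:R = - (w - 1) ->
  TLset n a b 1 = hexset w.
Proof.
move=> ha hb; apply/setP => x; rewrite !inE.
case: ha => ->; case: hb => ->; rewrite ?(opprK w) ?(opprK (w - 1));
move: (x == 1) (x == -1) (x == w) (x == - w) (x == w - 1) (x == - (w - 1));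
by do 6!case.
Qed.

Section HexZ.
Variables (n : nat) (n1 : (1 < n)%N) (n6 : coprime n 6).
Implicit Types (w x y : 'Z_n) (u h : {unit 'Z_n}).

Let U2 : 2%:R \is a @GRing.unit 'Z_n.
Proof. by move: n6; rewrite coprime6_units // => /andP[]. Qed.
Let U3 : 3%:R \is a @GRing.unit 'Z_n.
Proof. by move: n6; rewrite coprime6_units // => /andP[]. Qed.

Lemma card_hexset w : hex_sol w -> #|hexset w| = 6%N.
Proof. by move=> hw; rewrite cardsE (card_uniqP (hexseq_uniq U2 U3 hw)). Qed.

Lemma unit_val_cycle u : hex_sol (val u) -> unit_val <[u]>%G = hexset (val u).
Proof.
move=> hu; apply/setP => x; rewrite inE; apply/unit_valP/idP.
  case=> _ /cycleP[i ->] ->; rewrite FinRing.val_unitX.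
  elim: i => [|i IH]; first by rewrite expr0 inE eqxx.
  by rewrite exprS; apply: hexseq_mul.
have E2 := hexE hu; have E3 := hex_cube hu.
rewrite !inE => xE; suff [i ->] : exists i, x = val u ^+ i.
  by exists (u ^+ i)%g; rewrite ?mem_cycle // FinRing.val_unitX.
case/or4P: xE => [/eqP->|/eqP->|/eqP->|/or3P[]/eqP->].
- by exists 0%N; rewrite expr0.
- by exists 3%N; rewrite E3.
- by exists 1%N; rewrite expr1.
- by exists 4%N; rewrite exprSr E3 mulN1r.
- by exists 2%N; rewrite E2.
- by exists 5%N; rewrite -[5%N]/(3 + 2)%N exprD E3 E2 mulN1r.
Qed.

Lemma order_hex u : hex_sol (val u) -> #[u]%g = 6%N.
Proof.
move=> hu; rewrite -(card_hexset hu) -(unit_val_cycle hu).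
by rewrite card_imset //; apply: val_inj.
Qed.

Lemma hex_neq1 w : hex_sol w -> w != 1.
Proof.
move=> hw; apply/eqP => w1; move: hw; rewrite /hex_sol w1 expr1n subrr add0r.
by move/eqP; rewrite oner_eq0.
Qed.

Lemma frobenius_hex u : hex_sol (val u) -> frobenius_cyclic_kernel <[u]>%G.
Proof.
move=> hu; apply: frobenius_of_sub1_unit => [|h hH h1].
  exists u; rewrite ?cycle_id //; apply: contraNneq (hex_neq1 hu) => ->.
  by rewrite FinRing.val_unit1.
have hS k : k \in <[u]>%g -> val k \in hexseq (val u).
  move=> kH; have: val k \in unit_val <[u]>%G by apply/unit_valP; exists k.
  by rewrite unit_val_cycle // inE.
apply: (hexseq_sub_unit U2 U3 hu); first exact: hS.
  exact: (hS 1%g (group1 _)).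
by apply: contraNneq h1 => e; apply/eqP/val_inj.
Qed.

Lemma first_kind_hex u : hex_sol (val u) -> first_kind <[u]>%G (hexset (val u)).
Proof.
move=> hu; exists 1; rewrite orbitH1 unit_val_cycle //; split=> //.
  by apply: gen_set1_Zp; rewrite !inE eqxx.
by left; rewrite -/(order u) order_hex.
Qed.

(** Ensures that the natural number [a - 1] is positive, as a parameter of the circulant must be. *)
Lemma hex_sol_gt1 a : (0 < a < n)%N -> hex_sol (a%:R : 'Z_n) -> (1 < a)%N.
Proof.
case: a => [|[|a]] // _ /hex_neq1; by rewrite eqxx.
Qed.

Lemma frob_circ_hex a : (0 < a < n)%N -> hex_sol (a%:R : 'Z_n) ->
  frob_circ n a (a - 1).
Proof.
move=> an ha; have a1 := hex_sol_gt1 an ha.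
have eb : (a - 1)%:R = a%:R - 1 :> 'Z_n by rewrite natrB // ltnW.
split.
  rewrite TL_paramE // eb; apply/and3P; split=> //; last by have := hexseq_uniq U2 U3 ha; exact.
  by rewrite subn_gt0 a1; case/andP: an => _; apply: leq_ltn_trans (leq_subr _ _).
have [u eu] : exists u : {unit 'Z_n}, val u = a%:R.
  by have := hex_unit ha => U; exists (FinRing.unit 'Z_n U).
exists <[u]>%G; rewrite -eu in ha; split; first exact: frobenius_hex.
rewrite (@TLset_hexset _ (val u)); first exact: first_kind_hex.
  by left.
by left; rewrite eb eu.
Qed.

End HexZ.

(** * From a Frobenius circulant back to a root, up to signs of a and b *)

Lemma frob_circ_inv (n a b : nat) : (1 < n)%N -> frob_circ n a b ->
  coprime n 6 /\ exists w : 'Z_n, [/\ hex_sol w, a%:R = w \/ a%:R = - w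
     & b%:R = w - 1 \/ b%:R = - (w - 1)].
Proof.
move=> n1 [TL [H [frob [s [eS _ _]]]]].
have S1 : 1 \in TLset n a b 1 by rewrite !inE eqxx ?orbT.
have {s}eS : TLset n a b 1 = unit_val H.
  by rewrite eS; apply: orbitH_mem1; rewrite -eS.
move: TL; rewrite TL_paramE // => /and3P[_ _ unq].
set x := a%:R in unq *; set y := b%:R in unq *.
have eS' : TLset n a b 1 = [set z in [:: 1; -1; x; - x; y; - y]].
  apply/setP => z; rewrite !inE -!orbA; 
  move: (z == 1) (z == -1) (z == x) (z == - x) (z == y) (z == - y).
  by do 6!case.
have subU z : z \in TLset n a b 1 -> z != 1 -> z - 1 \is a GRing.unit.
  rewrite eS => /unit_valP[h hH ->] h1; apply: frobenius_sub1_unit frob hH _.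
  by apply: contraNneq h1 => ->.
have [x1 xN1 N11] : [/\ x != 1, - x != 1 & -1 != 1 :> 'Z_n].
  move: unq; rewrite /= !inE !negb_or -!andbA => /and4P[n11 n1x n1Nx _].
  by split; rewrite eq_sym.
have Um : x - 1 \is a GRing.unit by apply: subU; rewrite ?eS' ?inE ?eqxx ?orbT.
have Up : x + 1 \is a GRing.unit.
  have : - x - 1 \is a GRing.unit by apply: subU; rewrite ?eS' ?inE ?eqxx ?orbT.
  by rewrite -opprD unitrN.
have U2 : 2%:R \is a @GRing.unit 'Z_n.
  have : -1 - 1 \is a @GRing.unit 'Z_n by apply: subU; rewrite ?eS' ?inE ?eqxx ?orbT.
  by rewrite -opprD unitrN.
have cardH : #|H| = 6%N.
  rewrite -(card_imset _ val_inj) -/(unit_val H) -eS eS' cardsE.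
  by rewrite (card_uniqP unq).
have xS : x \in unit_val H by rewrite -eS eS' !inE eqxx !orbT.
have x6 : x ^+ 6 = 1.
  case/unit_valP: xS => h hH ->.
  by have := expg_cardG hH; rewrite cardH -FinRing.val_unitX => ->.
have [w hw xw] : exists2 w, hex_sol w & x = w \/ x = - w.
  (* If x^3 = 1, the unit x - 1 cancels from x^3 - 1 = (x - 1)(x^2 + x + 1), so -x is the root. *)
  have [x3|x3] := eqVneq (x ^+ 3) 1.
    exists (- x); last by right; rewrite opprK.
    apply: (mulrI Um); rewrite mulr0 /hex_sol.
    by have -> : (x - 1) * ((- x) ^+ 2 - - x + 1) = x ^+ 3 - 1 by [ring]; rewrite x3 subrr.
  exists x; last by left.
  (* Otherwise x^3 is an element of S other than 1, so x^3 - 1 is a unit, and it cancels together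
     with x + 1 from x^6 - 1. *)
  have U : x ^+ 3 - 1 \is a GRing.unit.
    by apply: subU => //; rewrite eS !exprS expr0 mulr1; do 2?apply: unit_valM.
  apply: (mulrI U); apply: (mulrI Up); rewrite !mulr0.
  have -> : (x + 1) * ((x ^+ 3 - 1) * (x ^+ 2 - x + 1)) = x ^+ 6 - 1 by ring.
  by rewrite x6 subrr.
have [Uwm Uwp] : w - 1 \is a GRing.unit /\ w + 1 \is a GRing.unit.
  case: xw => xw; first by rewrite -xw.
  have -> : w = - x by rewrite xw opprK.
  by split; [rewrite -opprD unitrN | rewrite addrC -opprB unitrN].
(* Modulo w^2 - w + 1, the number 3 equals -(w + 1)^2 (w - 1), a product of units. *)
have U3 : 3%:R \is a @GRing.unit 'Z_n.
  have -> : 3%:R = - ((w + 1) ^+ 2 * (w - 1)) + (w + 2%:R) * (w ^+ 2 - w + 1) :> 'Z_n by ring.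
  by rewrite hw mulr0 addr0 unitrN unitrM unitrX.
split; first by rewrite coprime6_units // U2.
exists w; split=> //.
have wS : w \in unit_val H.
  case: xw => [<- //|xw]; rewrite -eS eS' !inE.
  have -> : w = - x by rewrite xw opprK.
  by rewrite eqxx !orbT.
(* As w - 1 = w^2 lies in S and differs from 1, -1, w and -w, it must be b or -b. *)
have : w - 1 \in unit_val H by rewrite -(hexE hw) expr2 unit_valM.
rewrite -eS eS' => w1S.
have := hexseq_uniq U2 U3 hw; rewrite /= !inE !negb_or -!andbA.
move=> /and5P[_ _ _ n1w /and5P[_ _ _ n2w /and5P[_ _ n3w _ /andP[n4w _]]]].
rewrite eq_sym in n1w; rewrite eq_sym in n2w; rewrite eq_sym in n3w; rewrite eq_sym in n4w.
move: w1S; rewrite !inE (negbTE n1w) (negbTE n2w) /=.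
case/or4P => /eqP e.
- by case: xw e => -> e; rewrite e eqxx in n3w n4w.
- by case: xw e => -> e; rewrite e ?opprK eqxx in n3w n4w.
- by left.
by right; rewrite e opprK.
Qed.

(** * Prime factors of n *)

Lemma natr_Zp_eq (n i j : nat) : (1 < n)%N ->
  i%:R = j%:R :> 'Z_n <-> i = j %[mod n].
Proof.
move=> n1; split=> [/(congr1 val)|e]; first by rewrite /= !val_Zp_nat.
by rewrite -Zp_nat_mod // e Zp_nat_mod.
Qed.

(** A congruence between natural numbers can be reduced modulo a divisor of n, which a statement
    inside ['Z_n] does not allow directly. *)
Lemma hex_solE (n a : nat) : (1 < n)%N ->
  hex_sol (a%:R : 'Z_n) <-> (a * a + 1)%N = a %[mod n].
Proof.
move=> n1; rewrite -natr_Zp_eq // /hex_sol natrD natrM -expr2 addrAC.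
split=> [/eqP|->]; last by rewrite subrr.
by rewrite subr_eq0 => /eqP.
Qed.

(** The root reduces to an element of order 6 in the unit group of Z_p, so 6 divides p - 1. *)
Lemma hex_prime_mod6 (n p : nat) (w : 'Z_n) : (1 < n)%N -> coprime n 6 ->
  hex_sol w -> prime p -> (p %| n)%N -> (p %% 6 = 1)%N.
Proof.
move=> n1 n6; rewrite -[w]natr_Zp hex_solE // => hw pp pn.
have p1 := prime_gt1 pp.
have p6 : coprime p 6 := coprime_dvdl pn n6.
have hp : hex_sol ((val w)%:R : 'Z_p).
  by rewrite hex_solE //; apply/eqP; rewrite -(modn_dvdm _ pn) hw modn_dvdm.
pose u : {unit 'Z_p} := FinRing.unit 'Z_p (hex_unit hp).
have /order_dvdG : u \in units_Zp p by rewrite inE.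
rewrite order_hex // card_units_Zp ?prime_gt0 // totient_prime //.
by move: p1; lia.
Qed.

Lemma prod_mod6 (n : nat) : (0 < n)%N ->
  (forall p, prime p -> (p %| n)%N -> (p %% 6 = 1)%N) -> (n %% 6 = 1)%N.
Proof.
have [m] := ubnP n; elim: m n => // m IH n nm n0 hp.
case: (leqP n 1) => n1; first by have -> : n = 1%N by [apply/eqP; rewrite eqn_leq n1].
have p1 := pdiv_prime n1; have pd := pdiv_dvd n.
rewrite -(divnK pd) -modnMm (hp _ p1 pd) (IH (n %/ pdiv n)%N) //.
- by apply: (leq_trans (ltn_Pdiv _ _) (nm : (n <= m)%N)); rewrite // prime_gt1.
- by rewrite divn_gt0 ?pdiv_gt0 // dvdn_leq.
by move=> q q1 qd; apply: hp => //; apply: dvdn_trans qd (dvdn_div pd).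
Qed.

Lemma coprime_no_prime (m k : nat) :
  (forall p, prime p -> (p %| m)%N -> ~~ (p %| k)%N) -> coprime m k.
Proof.
move=> h; apply: contraT => cop.
case: (posnP (gcdn m k)) => [g0|g0].
  have := gcdn_gt0 m k; rewrite g0 => /esym/norP[]; rewrite -!eqn0Ngt => /eqP m0 /eqP k0.
  by have := h 2%N isT; rewrite m0 k0 !dvdn0 => /(_ isT).
have g1 : (1 < gcdn m k)%N by rewrite ltn_neqAle eq_sym cop.
have := h _ (pdiv_prime g1) (dvdn_trans (pdiv_dvd _) (dvdn_gcdl _ _)).
by rewrite (dvdn_trans (pdiv_dvd _) (dvdn_gcdr _ _)).
Qed.

(** * Idempotents of Z_n and sets of prime factors *)

Section Idempotents.
Variables (n : nat) (n1 : (1 < n)%N).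
Let n0 : (0 < n)%N := ltnW n1.
Let T : finType := seq_sub (primes n).
Implicit Types (D : {set T}) (q : T).

Definition prime_pred D : nat_pred := [pred p | p \in image val D].
Local Notation pi := prime_pred.

Lemma mem_prime_pred D q : (val q \in pi D) = (q \in D).
Proof. by rewrite inE (mem_image val_inj). Qed.

Definition idem_nat D : nat := chinese n`_(pi D) n`_((pi D)^') 0 1.

Lemma idem_nat_mod0 D : (n`_(pi D) %| idem_nat D)%N.
Proof. by rewrite /dvdn chinese_modl ?coprime_partC // mod0n. Qed.

Lemma idem_nat_mod1 D : idem_nat D = 1 %[mod n`_((pi D)^')].
Proof. by rewrite chinese_modr // coprime_partC. Qed.

Lemma dvdn_primes_part (rho : nat_pred) q : val q \in rho -> (val q %| n`_rho)%N.
Proof.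
move=> qr; have: val q \in primes n`_rho.
  by rewrite primes_part mem_filter qr (valP q).
by rewrite mem_primes => /and3P[].
Qed.

(** This recovers D from its idempotent, which yields injectivity. *)
Lemma dvdn_idem_nat D q : (val q %| idem_nat D)%N = (q \in D).
Proof.
apply/idP/idP => [qE|qD]; last first.
  by apply: dvdn_trans (idem_nat_mod0 D); rewrite dvdn_primes_part ?mem_prime_pred.
apply: contraLR qE => qD.
have d : (val q %| n`_((pi D)^'))%N by rewrite dvdn_primes_part // inE /= mem_prime_pred.
rewrite /dvdn -(modn_dvdm _ d) idem_nat_mod1 modn_dvdm // -/(dvdn _ _) dvdn1.
by have := valP q; rewrite mem_primes; case: (val q) => [|[|]].
Qed.

Definition idem D : 'Z_n := (idem_nat D)%:R.

Lemma idem_inj : injective idem.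
Proof.
move=> D1 D2 /natr_Zp_eq -/(_ n1) e; apply/setP => q.
have qn : (val q %| n)%N by have := valP q; rewrite mem_primes => /and3P[].
by rewrite -!dvdn_idem_nat /dvdn -(modn_dvdm _ qn) e modn_dvdm.
Qed.

Lemma mul_idem D : idem D * idem D = idem D.
Proof.
rewrite -natrM; apply/natr_Zp_eq => //; apply/eqP.
rewrite -[n in (_ %% n)%N](partnC (pi D) n0) -[X in _ == (_ %% X)%N](partnC (pi D) n0).
rewrite chinese_remainder ?coprime_partC //; apply/andP; split.
  have := idem_nat_mod0 D; rewrite /dvdn => /eqP e.
  by rewrite -modnMm e mod0n.
by rewrite -modnMm idem_nat_mod1 modnMm.
Qed.

(** Let k represent e and let D be the primes of n dividing k. Since n divides k(k - 1) and no prime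
    divides both factors, the D-part of n divides k and the complementary part divides k - 1. *)
Lemma idem_surj (e : 'Z_n) : e * e = e -> exists D, e = idem D.
Proof.
rewrite -[e]natr_Zp; set k := val e; rewrite -natrM => /natr_Zp_eq -/(_ n1) ek.
pose D := [set q : T | val q %| k]%N; exists D; apply/natr_Zp_eq => //; apply/eqP.
(* The sum [k + n.-1] represents k - 1 modulo n without truncated subtraction. *)
have nk : (n %| k * (k + n.-1))%N.
  rewrite /dvdn mulnDr -modnDml ek modnDml -{1}[k]muln1 -mulnDr add1n prednK //.
  by rewrite modnMl.
have qT p : prime p -> (p %| n)%N -> exists q : T, val q = p.
  move=> pp pn; have pin : p \in primes n by rewrite mem_primes pp n0.
  by exists (SeqSub pin).
rewrite -[n in (_ %% n)%N](partnC (pi D) n0) -[X in _ == (_ %% X)%N](partnC (pi D) n0).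
rewrite chinese_remainder ?coprime_partC //; apply/andP; split.
  have /eqP -> := idem_nat_mod0 D; rewrite -/(dvdn _ _).
  rewrite -(@Gauss_dvdl _ _ (k + n.-1)); first exact: dvdn_trans (dvdn_part _ _) nk.
  apply: coprime_no_prime => p pp pd.
  have pn := dvdn_trans pd (dvdn_part _ _).
  have [q qp] := qT _ pp pn.
  have : p \in pi D by apply: pnatPpi (part_pnat (pi D) n) _; rewrite mem_primes pp part_gt0.
  rewrite -qp mem_prime_pred inE qp => pk; rewrite dvdn_addr //.
  apply: contraL (prime_gt1 pp) => pn'.
  have : (p %| n.-1.+1)%N by rewrite prednK.
  by rewrite -addn1 dvdn_addr // dvdn1 => /eqP->.
rewrite idem_nat_mod1.
have : (n`_((pi D)^') %| k + n.-1)%N.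
  rewrite -(@Gauss_dvdr _ k); first exact: dvdn_trans (dvdn_part _ _) nk.
  apply: coprime_no_prime => p pp pd.
  have pn := dvdn_trans pd (dvdn_part _ _).
  have [q qp] := qT _ pp pn.
  have : p \in (pi D)^' by apply: pnatPpi (part_pnat _ n) _; rewrite mem_primes pp part_gt0.
  by rewrite -qp inE /= mem_prime_pred inE.
set m := partn _ _ => mk; have mn : (m %| n)%N := dvdn_part _ _.
have -> : k = k + n %[mod m] by rewrite -modnDmr (eqP mn) addn0.
by rewrite -(prednK n0) addnS -addn1 -modnDml (eqP mk).
Qed.

Lemma card_idem : #|[set e : 'Z_n | e * e == e]| = (2 ^ size (primes n))%N.
Proof.
have -> : [set e : 'Z_n | e * e == e] = idem @: [set: {set T}].
  apply/setP => e; rewrite inE; apply/eqP/imsetP => [/idem_surj[D ->]|[D _ ->]].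
    by exists D; rewrite ?inE.
  exact: mul_idem.
rewrite card_imset; last exact: idem_inj.
by rewrite -powersetT card_powerset cardsT card_seq_sub ?primes_uniq.
Qed.

End Idempotents.

(** * Counting roots and conjugate pairs of roots *)

Section HexCount.
Variables (n : nat) (n1 : (1 < n)%N) (n6 : coprime n 6).
Implicit Types x y : 'Z_n.

Definition hex_roots : {set 'Z_n} := [set y | y ^+ 2 - y + 1 == 0].

Lemma hex_rootsP y : reflect (hex_sol y) (y \in hex_roots).
Proof. by rewrite inE; apply: eqP. Qed.

Lemma hex_disc_unit y : hex_sol y -> 1 - 2%:R * y \is a GRing.unit.
Proof.
move=> hy; rewrite -(@unitrX_pos _ _ 2) //.
have -> : (1 - 2%:R * y) ^+ 2 = 4%:R * (y ^+ 2 - y + 1) - 3%:R by ring.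
rewrite hy mulr0 sub0r unitrN.
by move: n6; rewrite coprime6_units // => /andP[].
Qed.

Lemma card_hex_roots x : hex_sol x -> #|hex_roots| = (2 ^ size (primes n))%N.
Proof.
move=> hx.
have -> : hex_roots = (fun e => x + e * (1 - 2%:R * x)) @: [set e : 'Z_n | e * e == e].
  apply/setP => y; apply/hex_rootsP/imsetP.
    (* With d = 1 - 2x and y = x + e d, the values of the polynomial at y and x differ by (e^2 - e)
       d^2, and d^2 is a unit. *)
    move=> hy; exists ((y - x) / (1 - 2%:R * x)); last by rewrite divrK ?hex_disc_unit // addrC subrK.
    have U := hex_disc_unit hx.
    set e := _ / _; have eE : e * (1 - 2%:R * x) = y - x by rewrite divrK.
    rewrite inE -subr_eq0; apply/eqP/(mulIr (unitrX 2 U)); rewrite mul0r.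
    have -> : (e * e - e) * (1 - 2%:R * x) ^+ 2 =
      (e * (1 - 2%:R * x)) ^+ 2 - e * (1 - 2%:R * x) * (1 - 2%:R * x) by ring.
    rewrite eE; have -> : (y - x) ^+ 2 - (y - x) * (1 - 2%:R * x) =
      (y ^+ 2 - y + 1) - (x ^+ 2 - x + 1) by ring.
    by rewrite hy hx subrr.
  case=> e; rewrite inE => /eqP ee ->; rewrite /hex_sol.
  have -> : (x + e * (1 - 2%:R * x)) ^+ 2 - (x + e * (1 - 2%:R * x)) + 1 =
    (x ^+ 2 - x + 1) + (e * e - e) * (1 - 2%:R * x) ^+ 2 by ring.
  by rewrite hx ee subrr mul0r addr0.
rewrite card_imset ?card_idem // => e f /addrI; exact: mulIr (hex_disc_unit hx) _ _.
Qed.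

(** The roots y and 1 - y have the same hexagon; the one with the smaller representative is kept. *)
Definition hex_reps : {set 'Z_n} := [set y in hex_roots | (val y < val (1 - y)%R)%N].

Lemma hex_sol_conj y : hex_sol y -> hex_sol (1 - y).
Proof.
move=> hy; rewrite /hex_sol; have -> : (1 - y) ^+ 2 - (1 - y) + 1 = y ^+ 2 - y + 1 by ring.
exact: hy.
Qed.

Lemma hex_conj_neq y : hex_sol y -> val y != val (1 - y).
Proof.
move=> /hex_disc_unit; apply: contraTneq => /val_inj e.
have -> : 1 - 2%:R * y = (1 - y) - y by ring.
by rewrite -e subrr unitr0.
Qed.

Lemma card_hex_reps x : hex_sol x -> #|hex_reps| = (2 ^ (size (primes n) - 1))%N.
Proof.
move=> hx; have := card_hex_roots hx; rewrite -(cardsID hex_reps).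
have -> : hex_roots :&: hex_reps = hex_reps.
  by apply/setIidPr/subsetP => y; rewrite inE => /andP[].
have conjK : involutive (fun y : 'Z_n => 1 - y) by move=> y; rewrite subKr.
have -> : hex_roots :\: hex_reps = (fun y => 1 - y) @: hex_reps.
  apply/setP => y; rewrite (can_imset_pre _ conjK) !inE -[(_ == 0)]/(_ == _).
  rewrite subKr.
  have -> : (y ^+ 2 - y + 1 == 0) = ((1 - y) ^+ 2 - (1 - y) + 1 == 0).
    by congr (_ == _); ring.
  case: eqP => [h|//]; rewrite andbT -leqNgt leq_eqVlt.
  have /hex_conj_neq : hex_sol y by rewrite -[y](subKr 1); apply: hex_sol_conj.
  by rewrite eq_sym => /negbTE->.
rewrite (card_imset _ (can_inj conjK)) addnn -mul2n.
(* Makes the exponent [size (primes n) - 1] a genuine predecessor. *)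
have : (0 < size (primes n))%N.
  rewrite lt0n size_eq0; apply/eqP => e.
  have : pdiv n \in primes n by rewrite mem_primes pdiv_prime // pdiv_dvd ltnW.
  by rewrite e.
case: (size _) => // l _; rewrite expnS subn1 => /eqP.
by rewrite eqn_mul2l => /eqP.
Qed.

End HexCount.

(** * Graph isomorphisms between hexagonal circulants *)

Section HexGraph.
Variables (n : nat) (n7 : (7 < n)%N) (n6 : coprime n 6).
Let n1 : (1 < n)%N := ltn_trans (isT : 1 < 7)%N n7.
Implicit Types (w x y z s t : 'Z_n).

Let U2 : 2%:R \is a @GRing.unit 'Z_n.
Proof. by move: n6; rewrite coprime6_units // => /andP[]. Qed.
Let U3 : 3%:R \is a @GRing.unit 'Z_n.
Proof. by move: n6; rewrite coprime6_units // => /andP[]. Qed.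

Let seven_neq0 : 7%:R <> 0 :> 'Z_n.
Proof. by move/(@natr_Zp_eq n 7 0 n1); rewrite mod0n modn_small. Qed.
Let three_neq0 : 3%:R <> 0 :> 'Z_n.
Proof. by move=> e; move: U3; rewrite e unitr0. Qed.
Let two_neq0 : 2%:R <> 0 :> 'Z_n.
Proof. by move=> e; move: U2; rewrite e unitr0. Qed.
Let one_neq0 : 1 <> 0 :> 'Z_n.
Proof. by apply/eqP/oner_neq0. Qed.

Lemma hexset_unit_val w : hex_sol w ->
  exists H : {group {unit 'Z_n}}, hexset w = unit_val H.
Proof.
move=> hw; pose u : {unit 'Z_n} := FinRing.unit 'Z_n (hex_unit hw).
by exists <[u]>%G; rewrite unit_val_cycle.
Qed.

Lemma hexsetM w x y : hex_sol w -> x \in hexset w -> y \in hexset w ->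
  x * y \in hexset w.
Proof. by case/hexset_unit_val => H ->; apply: unit_valM. Qed.

Lemma hexset_unit w x : hex_sol w -> x \in hexset w -> x \is a GRing.unit.
Proof. by case/hexset_unit_val => H -> /unit_valP[h _ ->]; apply: valP. Qed.

Lemma hexset_div w x y : hex_sol w -> x \in hexset w -> y \in hexset w ->
  y / x \in hexset w.
Proof.
case/hexset_unit_val => H -> /unit_valP[h hH ->] yH; apply: unit_valM => //.
by apply/unit_valP; exists h^-1%g; rewrite ?groupV // FinRing.val_unitV.
Qed.

Lemma hexset_mulr w x s : hex_sol w -> s \in hexset w ->
  (s * x \in hexset w) = (x \in hexset w).
Proof.
move=> hw sS; apply/idP/idP => [sx|]; last exact: hexsetM.
by rewrite -[x](mulKr (hexset_unit hw sS)) mulrC hexset_div.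
Qed.

Lemma hexsetN w x : (- x \in hexset w) = (x \in hexset w).
Proof.
rewrite !in_set; apply/idP/idP => /hexseqN //.
by rewrite (opprK x).
Qed.

Variant hexset_spec w : 'Z_n -> Prop :=
  | Hex1 : hexset_spec w 1
  | HexN1 : hexset_spec w (-1)
  | Hexw : hexset_spec w w
  | HexNw : hexset_spec w (- w)
  | Hexw1 : hexset_spec w (w - 1)
  | HexNw1 : hexset_spec w (- (w - 1)).

Lemma hexsetP w x : x \in hexset w -> hexset_spec w x.
Proof.
rewrite in_set.
by do 6!(rewrite in_cons; case/orP => [/eqP->|]; first by constructor).
Qed.

(** Opposite vertices of the hexagon differ by 2 up to a hexagon factor. If 2 were in the hexagon, w
    would be 2, -2, 3 or -1, where w^2 - w + 1 is 3 or 7, or else 1 or 3 would vanish. *)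
Lemma two_notin_hexset w : hex_sol w -> 2%:R \notin hexset w.
Proof.
move=> hw; apply/negP => h.
have [x xS] : exists2 x, x \in hexset w & 2%:R = x by exists 2%:R.
case/hexsetP: xS => e.
- by apply: one_neq0; apply/(addrI 1); rewrite addr0 -[RHS]e.
- by apply: three_neq0; rewrite mulrS e subrr.
- by apply: three_neq0; rewrite -hw -e; ring.
- by apply: seven_neq0; rewrite -hw -[w](opprK w) -e; ring.
- by apply: seven_neq0; rewrite -hw -[w](subrK 1) -e; ring.
- by apply: three_neq0; rewrite -hw -[w](subrK 1) -[w - 1]opprK -e; ring.
Qed.

(** Vertices two steps apart differ by w + 1 up to a hexagon factor, so they are not adjacent
    either. *)
Lemma add1_notin_hexset w : hex_sol w -> w + 1 \notin hexset w.
Proof.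
move=> hw; apply/negP => h.
have [x xS] : exists2 x, x \in hexset w & w + 1 = x by exists (w + 1).
case/hexsetP: xS => e.
- by apply: one_neq0; rewrite -hw; have -> : w = 0 by [apply: (addIr 1); rewrite e add0r]; ring.
- apply: seven_neq0; rewrite -hw; have -> : w = - 2%:R; last by ring.
  by apply: (addIr 1); rewrite e; ring.
- by apply: one_neq0; apply: (addrI w); rewrite e addr0.
- apply: seven_neq0; have e2 : 2%:R * w = -1.
    by apply/eqP; rewrite -subr_eq0 -[X in _ == X](subrr (- w)) -{1}e; apply/eqP; ring.
  have -> : 7%:R = 4%:R * (w ^+ 2 - w + 1) - (2%:R * w) ^+ 2 + 2%:R * (2%:R * w) + 3%:R :> 'Z_n by ring.
  have -> : 4%:R * (w ^+ 2 - w + 1) = 0 by rewrite hw mulr0.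
  by rewrite e2; ring.
- by apply: two_neq0; apply: (addrI (w - 1)); rewrite addr0 -{2}e; ring.
apply: two_neq0; apply: (mulIr (hex_unit hw)); rewrite mul0r.
by rewrite -(subrr (w + 1)) {2}e; ring.
Qed.

(* Describes the antipode of [s] in the hexagon by adjacencies alone; it is here
   that 7 must be nonzero, as TL_7 is the complete graph. *)
Lemma hexset_antipode w s t : hex_sol w -> s \in hexset w -> t \in hexset w ->
  (t = - s) <-> [/\ t != s, s - t \notin hexset w &
    forall u, u \in hexset w -> u - s \in hexset w -> u - t \notin hexset w].
Proof.
move=> hw sS tS; have Us := hexset_unit hw sS.
have n2 := two_notin_hexset hw; have nw := add1_notin_hexset hw.
have S0 : 0 \notin hexset w.
  by apply/negP => /(hexset_unit hw); rewrite unitr0.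
have S1 : 1 \in hexset w by rewrite !inE eqxx.
have Sw : w \in hexset w by rewrite !inE eqxx !orbT.
have Sw1 : w - 1 \in hexset w by rewrite !inE eqxx !orbT.
split=> [->|[ts st far]].
  have E : s - - s = s * 2%:R by ring.
  split.
  - by apply/eqP => e; apply: two_neq0; apply: (mulrI Us); rewrite mulr0 -E e subrr.
  - by rewrite E hexset_mulr.
  (* Dividing by s reduces to the case s = 1. *)
  move=> u uS; rewrite -[u](mulVKr Us); set v := s^-1 * u.
  have -> : s * v - s = s * (v - 1) by ring.
  have -> : s * v - - s = s * (v + 1) by ring.
  rewrite !hexset_mulr //.
  have vS : v \in hexset w by rewrite /v mulrC hexset_div.
  have nw2 : w - 1 - 1 \notin hexset w.
    rewrite (_ : w - 1 - 1 = (w - 1) * (w + 1)) ?hexset_mulr //.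
    by rewrite -(hexE hw); have := hex_cube hw => w3; rewrite mulrDr mulr1 -exprSr w3 (hexE hw); ring.
  move: (v) vS => _ /hexsetP[].
  - by rewrite subrr (negbTE S0).
  - by rewrite addNr.
  - by [].
  - by rewrite -opprD hexsetN (negbTE nw).
  - by rewrite (negbTE nw2).
  - by move=> _; rewrite -hexsetN opprD opprK.
have vS : s^-1 * t \in hexset w by rewrite mulrC hexset_div.
move: ts st far; rewrite -[t](mulVKr Us); move: (s^-1 * t) vS => v vS.
have hs x : (s * x \in hexset w) = (x \in hexset w) := hexset_mulr x hw sS.
(* The vertices s w and s (1 - w) are adjacent to s. Those two steps away share a neighbour with it:
   s (1 - w) for -s w, and s w for s (w - 1). *)
case/hexsetP: vS => ts st far.
- by rewrite mulr1 eqxx in ts.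
- by rewrite mulrN1.
- by move: st; rewrite -{1}[s]mulr1 -mulrBr hs -hexsetN opprB Sw1.
- have uS : s * (1 - w) \in hexset w by rewrite hs -hexsetN opprB.
  have usS : s * (1 - w) - s \in hexset w.
    by rewrite (_ : _ - s = s * - w) ?hs ?hexsetN //; ring.
  by case/negP: (far _ uS usS); rewrite (_ : _ - _ = s) //; ring.
- have uS : s * w \in hexset w by rewrite hs.
  have usS : s * w - s \in hexset w.
    by rewrite (_ : _ - s = s * (w - 1)) ?hs //; ring.
  by case/negP: (far _ uS usS); rewrite (_ : _ - _ = s) //; ring.
by move: st; rewrite (_ : s - _ = s * w) ?hs ?Sw //; ring.
Qed.

(* Since z + 1 and z - 1 are antipodal neighbours of z, so are their images, and
   f (z + 1) - f z does not depend on z. *)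
Lemma graph_iso_affine w w' : hex_sol w -> hex_sol w' ->
  graph_iso (hexset w) (hexset w') ->
  exists2 c, c \in hexset w' & forall s, s \in hexset w -> s * c \in hexset w'.
Proof.
move=> hw hw' [f fP]; pose d z := f (z + 1) - f z.
have fS z s : (s \in hexset w) = (f (z + s) - f z \in hexset w').
  by have := fP (z + s) z; rewrite /cay_adj addrC addKr.
have S1 : 1 \in hexset w by rewrite !inE eqxx.
have dS z : d z \in hexset w' by rewrite -fS.
have dconst z : d z = d (z - 1).
  rewrite /d subrK -[RHS]opprB; apply/esym/eqP; rewrite eqr_oppLR; apply/eqP.
  have Sm1 : f (z - 1) - f z \in hexset w' by rewrite -fS hexsetN.
  apply/(hexset_antipode hw' (dS z) Sm1).
  have [] := (hexset_antipode hw S1 (_ : -1 \in hexset w)).1 (erefl _); first by rewrite hexsetN.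
  move=> ne nadj far; split.
  - by rewrite /d (inj_eq (addIr _)) (inj_eq perm_inj) (inj_eq (addrI _)).
  - have := fP (z + 1) (z - 1); rewrite /cay_adj.
    have -> : z + 1 - (z - 1) = 1 - -1 by ring.
    have -> : d z - (f (z - 1) - f z) = f (z + 1) - f (z - 1) by rewrite /d; ring.
    by move=> <-.
  (* Pulling v back along f turns a common neighbour of the images into one of 1 and -1, which [far]
     forbids. *)
  move=> v; pose y := (f^-1%g : {perm 'Z_n}) (v + f z) - z.
  have fy : f (z + y) = v + f z by rewrite /y addrC subrK permKV.
  have -> : v = f (z + y) - f z by rewrite fy addrK.
  rewrite -fS => yS; rewrite /d.
  have -> : f (z + y) - f z - (f (z + 1) - f z) = f (z + y) - f (z + 1) by ring.
  have -> : f (z + y) - f z - (f (z - 1) - f z) = f (z + y) - f (z - 1) by ring.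
  have := fP (z + y) (z + 1); rewrite /cay_adj => <-.
  have := fP (z + y) (z - 1); rewrite /cay_adj => <-.
  have -> : z + y - (z + 1) = y - 1 by ring.
  have -> : z + y - (z - 1) = y - -1 by ring.
  exact: far.
have dk (k : nat) : d k%:R = d 0.
  by elim: k => [//|k <-]; rewrite dconst -natr1 addrK.
have fk (k : nat) : f k%:R = f 0 + k%:R * d 0.
  elim: k => [|k IH]; first by rewrite mul0r addr0.
  have -> : f k.+1%:R = f k%:R + d k%:R by rewrite /d natr1 addrC subrK.
  by rewrite dk IH -natr1 mulrDl mul1r -(addrA (f 0)).
exists (d 0) => // s sS; have := fS 0 s; rewrite sS add0r.
by rewrite -[s in f s]natr_Zp fk natr_Zp [f 0 + _]addrC addrK.
Qed.

(** Of the six powers of w', only w' and its inverse 1 - w' can be roots: any other would force 1, 2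
    or 3 to vanish. *)
Lemma hex_sol_mem w w' : hex_sol w -> hex_sol w' -> w \in hexset w' ->
  w = w' \/ w = 1 - w'.
Proof.
move=> hw hw' ww'.
have [x xS] : exists2 x, x \in hexset w' & w = x by exists w.
case/hexsetP: xS => e; last by right; rewrite e opprB.
- by case/eqP: (hex_neq1 hw).
- by case: three_neq0; rewrite -hw e; ring.
- by left.
- case: two_neq0; apply: (mulIr (hex_unit hw')); rewrite mul0r.
  have -> : 2%:R * w' = ((- w') ^+ 2 - - w' + 1) - (w' ^+ 2 - w' + 1) by ring.
  by rewrite hw' -e hw subrr.
case: two_neq0; apply: (mulIr (hex_unit hw)); rewrite mul0r.
have -> : 2%:R * w = ((w + 1) ^+ 2 - (w + 1) + 1) - (w ^+ 2 - w + 1) by ring.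
have <- : w' = w + 1 by rewrite e subrK.
by rewrite hw hw' subrr.
Qed.

Lemma graph_iso_hexset w w' : hex_sol w -> hex_sol w' ->
  graph_iso (hexset w) (hexset w') -> w = w' \/ w = 1 - w'.
Proof.
move=> hw hw' /(graph_iso_affine hw hw')[c cS cP]; apply: hex_sol_mem => //.
(* Both c and w c lie in the hexagon of w', which is a group, so w does too. *)
by rewrite -(hexset_mulr w hw' cS) mulrC cP // !inE eqxx !orbT.
Qed.

End HexGraph.

(** * Conjugate roots, and assembly of the equivalence with its consequences *)

Lemma hexset_conj (n : nat) (w : 'Z_n) : hexset (1 - w) = hexset w.
Proof.
apply/setP => x; rewrite !inE.
have -> : 1 - w - 1 = - w by ring.
rewrite (opprK w) (opprB 1 w) -(opprB w 1).
move: (x == 1) (x == -1) (x == w) (x == - w) (x == w - 1) (x == - (w - 1)).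
by do 6!case.
Qed.

Lemma graph_iso_eq (n : nat) (S1 S2 : {set 'Z_n}) : S1 = S2 -> graph_iso S1 S2.
Proof. by move=> ->; exists 1%g => x y; rewrite !perm1. Qed.

Lemma frob_circ_cycle (n a : nat) : (1 < n)%N -> coprime n 6 ->
  (0 < a < n)%N -> hex_sol (a%:R : 'Z_n) ->
  exists u : {unit 'Z_n}, val u = a%:R /\
    TLset n a (a - 1) 1 = unit_val <[u]>%G.
Proof.
move=> n1 n6 an ha; exists (FinRing.unit 'Z_n (hex_unit ha)); split=> //.
rewrite unit_val_cycle //; apply: TLset_hexset; left => //.
by rewrite natrB //; case/andP: an.
Qed.

Theorem theorem2p2 (n : nat) : (7 <= n)%N ->
  ((exists a b : nat, frob_circ n a b) <->
     ((n %% 6 = 1)%N /\ exists x : 'Z_n, hex_sol x)) /\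
  ((exists a b : nat, frob_circ n a b) ->
   [/\ (* (c) *)
       forall p : nat, prime p -> (p %| n)%N -> (p %% 6 = 1)%N,
       (* (d): solutions give Frobenius circulants TL_n(a,a-1,1) *)
       forall a : nat, (0 < a < n)%N -> hex_sol (a%:R : 'Z_n) ->
         frob_circ n a (a - 1) /\
         exists u : {unit 'Z_n},
           val u = a%:R /\
           [set (val h : 'Z_n) | h in <[u]>%g]
             = [set 1; -1; a%:R; - a%:R; (a%:R) ^+ 2; - (a%:R) ^+ 2] /\
           [set (val h : 'Z_n) | h in <[u]>%g]
             = [set 1; -1; a%:R; - a%:R; a%:R - 1; - (a%:R - 1)] /\
           frobenius_cyclic_kernel <[u]>%g /\
           first_kind <[u]>%g (TLset n a (a - 1) 1) /\
           arc_transitive <[u]>%g (TLset n a (a - 1) 1) /\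
           rotational (TLset n a (a - 1) 1) /\
           geometric n a (a - 1) 1 /\
           complete_rotation (TLset n a (a - 1) 1) u /\
           exists v : {unit 'Z_n}, val v = - (a%:R) ^+ 2 /\
             complete_rotation (TLset n a (a - 1) 1) v,
       (* (d): vice versa, and b = a - 1 (up to sign) *)
       (forall a b : nat, frob_circ n a b ->
          hex_sol (a%:R : 'Z_n) \/ hex_sol (- (a%:R : 'Z_n))) /\
       (forall a b : nat, hex_sol (a%:R : 'Z_n) -> frob_circ n a b ->
          (b%:R : 'Z_n) = a%:R - 1 \/ (b%:R : 'Z_n) = - (a%:R - 1)) &
       (* (e) *)
       (exists reps : seq (nat * nat),
          [/\ size reps = (2 ^ (size (primes n) - 1))%N,
              forall r, r \in reps -> frob_circ n r.1 r.2,
              forall i j : nat, (i < j < size reps)%N ->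
                ~ graph_iso (TLset n (nth (0, 0) reps i).1 (nth (0, 0) reps i).2 1)
                            (TLset n (nth (0, 0) reps j).1 (nth (0, 0) reps j).2 1)
            & forall a b : nat, frob_circ n a b ->
                exists2 r, r \in reps & graph_iso (TLset n a b 1) (TLset n r.1 r.2 1)]) /\
       (forall a b : nat, frob_circ n a b ->
          exists a' : nat, [/\ (0 < a' < n)%N, hex_sol (a'%:R : 'Z_n) &
             graph_iso (TLset n a b 1) (TLset n a' (a' - 1) 1)])]).
Proof.
move=> n7; have n1 : (1 < n)%N := leq_trans (isT : 2 <= 7)%N n7.
have natr_val (w : 'Z_n) : ((val w)%:R : 'Z_n) = w by rewrite natr_Zp.
have val_gt0 (w : 'Z_n) : hex_sol w -> (0 < val w < n)%N.
  move=> hw; rewrite ltn_val_Zp // andbT lt0n; apply: contraTneq (hex_unit hw) => w0.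
  by rewrite -[w]natr_val w0 unitr0.
split.
  split=> [[a [b fab]]|[n6 [x hx]]].
    have [n6 [w [hw _ _]]] := frob_circ_inv n1 fab.
    split; last by exists w.
    by apply: prod_mod6 (ltnW n1) _ => p; apply: hex_prime_mod6 hw.
  have cop : coprime n 6 by rewrite -coprime_modl n6.
  exists (val x), (val x - 1)%N; apply: frob_circ_hex; rewrite ?natr_val //.
  exact: val_gt0.
move=> [a0 [b0 /(frob_circ_inv n1)[n6 [w0 [hw0 _ _]]]]].
have two_unit : 2%:R \is a @GRing.unit 'Z_n.
  by move: n6; rewrite coprime6_units // => /andP[].
split.
- by move=> p; apply: hex_prime_mod6 hw0.
- move=> a an ha; split; first exact: frob_circ_hex.
  have [u [ua eS]] := frob_circ_cycle n1 n6 an ha.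
  have hu : hex_sol (val u) by rewrite ua.
  have eH : [set (val h : 'Z_n) | h in <[u]>%g] = hexset (val u) := unit_val_cycle hu.
  exists u; split=> //; rewrite eH ua; split.
    apply/setP => x; rewrite !inE (hexE ha).
    by rewrite !orbA.
  split; first by apply/setP => x; rewrite !inE !orbA.
  split; first exact: (frobenius_hex n1 n6 hu).
  rewrite eS; split; first by rewrite unit_val_cycle //; apply: (first_kind_hex n1 n6 hu).
  split; first exact: (arc_transitive_unit_val <[u]>%G).
  split; first by exists u; apply: complete_rotation_cycle.
  split.
    (* The relation a - (a - 1) - 1 = 0, with negatives taken as complements in n. *)
    exists a, (n - (a - 1))%N, (n - 1)%N; rewrite !inE !eqxx !orbT; split=> //.
    have -> : (a + (n - (a - 1)) + (n - 1) = n + n)%N.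
      by clear -an; lia.
    by rewrite modnDl modnn.
  split; first exact: complete_rotation_cycle.
  (* Since a^3 = -1, the inverse of a is -a^2, which generates the same cyclic group. *)
  exists (u^-1)%g; split.
    rewrite FinRing.val_unitV ua; apply: (mulrI (hex_unit ha)).
    by rewrite divrr ?(hex_unit ha) // mulrN -exprS (hex_cube ha) opprK.
  have -> : unit_val <[u]>%G = unit_val <[u^-1]>%G by rewrite /unit_val /= cycleV.
  exact: complete_rotation_cycle.
- split=> [a b /(frob_circ_inv n1)[_ [w [hw [->|->] _]]]|]; [by left| by right; rewrite opprK|].
  move=> a b ha /(frob_circ_inv n1)[_ [w [hw [aw|aw] bw]]]; first by rewrite aw.
  (* If w and -w were both roots, the difference 2w of the two polynomial values would vanish,
     although it is a unit. *)
  have := hex_unit hw; rewrite -(unitrMr _ two_unit).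
  have -> : 2%:R * w = ((- w) ^+ 2 - - w + 1) - (w ^+ 2 - w + 1) by ring.
  by rewrite hw -aw ha subrr unitr0.
split; last first.
  move=> a b /(frob_circ_inv n1)[_ [w [hw aw bw]]]; exists (val w).
  rewrite natr_val; split=> //; first exact: val_gt0.
  apply: graph_iso_eq; rewrite (TLset_hexset aw bw); symmetry.
  apply: TLset_hexset; left; rewrite ?natrB ?natr_val //.
  by case/andP: (val_gt0 _ hw).
have TLval (w : 'Z_n) : hex_sol w -> TLset n (val w) (val w - 1) 1 = hexset w.
  move=> hw; apply: TLset_hexset; left; rewrite ?natrB ?natr_val //.
  by case/andP: (val_gt0 _ hw).
pose s := enum (hex_reps n); pose g (w : 'Z_n) : nat * nat := (val w, val w - 1)%N.
have sP w : w \in s -> hex_sol w /\ (val w < val (1 - w)%R)%N.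
  by rewrite mem_enum inE => /andP[/hex_rootsP].
have size_s : size s = (2 ^ (size (primes n) - 1))%N by rewrite -cardE (card_hex_reps n1 n6 hw0).
exists [seq g w | w <- s]; split; first by rewrite size_map.
- move=> r /mapP[w /sP[hw _] ->]; apply: frob_circ_hex; rewrite ?natr_val //.
  exact: val_gt0.
- rewrite size_map => i j /andP[ij js]; have is_ := ltn_trans ij js.
  rewrite !(nth_map 0) //=.
  set x := nth 0 s i; set y := nth 0 s j.
  have [hx xlt] : hex_sol x /\ _ := sP x (mem_nth 0 is_).
  have [hy ylt] : hex_sol y /\ _ := sP y (mem_nth 0 js).
  rewrite !TLval //.
  (* For n = 7 there is only 2^0 = 1 representative, so two indices i < j exclude that case. *)
  have n8 : (7 < n)%N.
    rewrite ltn_neqAle n7 andbT; apply: contraTneq js => n_eq.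
    by rewrite size_s -n_eq -leqNgt (leq_trans _ ij).
  case/(graph_iso_hexset n8 n6 hx hy) => [xy|xy].
    have := nth_uniq 0 is_ js (enum_uniq _); rewrite -/x -/y xy eqxx.
    by move/esym/eqP => e; rewrite e ltnn in ij.
  (* Conjugate representatives would each be smaller than the other. *)
  move: xlt ylt; rewrite xy subKr => h1 h2.
  by have := ltn_trans h1 h2; rewrite ltnn.
move=> a b /(frob_circ_inv n1)[_ [w [hw aw bw]]].
rewrite (TLset_hexset aw bw).
have [lt|ge] := ltnP (val w) (val (1 - w)%R).
  exists (g w); first by apply: map_f; rewrite mem_enum inE lt andbT; apply/hex_rootsP.
  by apply: graph_iso_eq; rewrite /= TLval.
have hw' := hex_sol_conj hw.
exists (g (1 - w)).
  apply: map_f; rewrite mem_enum inE subKr; apply/andP; split; first exact/hex_rootsP.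
  by rewrite ltn_neqAle ge andbT eq_sym (hex_conj_neq n1 n6 hw).
by apply: graph_iso_eq; rewrite -hexset_conj -(TLval _ hw').
Qed.
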